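(* Let $G$ be a graph of order $n$ having $t$ twin equivalence classes. Then $$\gamma_{\rm sp}(G)\ge n-t.$$ Furthermore, if $G$ is connected and $t\ge 3$, then $$\gamma_{\rm sp}(G)\ge n-t+1.$$
   Context: All graphs are finite, simple and undirected. For a vertex $v$ of a graph $G$, $N(v)$ denotes the set of vertices adjacent to $v$ and $N[v]=N(v)\cup\{v\}$. For $D\subseteq V(G)$ write $\overline{D}=V(G)\setminus D$. A set $D\subseteq V(G)$ is a super dominating set of $G$ if for every $u\in\overline{D}$ there exists $v\in D$ such that $N(v)\cap\overline{D}=\{u\}$; the super domination number $\gamma_{\rm sp}(G)$ is the minimum cardinality of a super dominating set of $G$. The twin equivalence relation on $V(G)$ is defined by $x\,\mathcal{R}\,y$ if and only if $N[x]=N[y]$ or $N(x)=N(y)$; its equivalence classes are called twin equivalence classes. *)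

(* Defs.v *)
(* Plain MathComp: a simple graph is a symmetric irreflexive relation
   [e : rel V] on a finite type [V]. *)
From mathcomp Require Import all_boot.

Set Implicit Arguments.
Unset Strict Implicit.
Unset Printing Implicit Defensive.

Section SuperDomination.

Variables (V : finType) (e : rel V).

Definition open_nbh (v : V) : {set V} := [set u | e v u].

Definition closed_nbh (v : V) : {set V} := v |: open_nbh v.

Definition super_dominating (D : {set V}) : bool :=
  [forall u in ~: D, exists v in D, open_nbh v :&: ~: D == [set u]].

Lemma super_dominatingT : super_dominating setT.
Proof. by apply/forall_inP => u; rewrite !inE. Qed.

Definition super_domination_number : nat :=
  #|[arg min_(D < setT | super_dominating D) #|D|]|.

Lemma super_domination_numberP :
  (exists2 D, super_dominating D & #|D| = super_domination_number) /\
  (forall D, super_dominating D -> super_domination_number <= #|D|).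
Proof.
rewrite /super_domination_number.
case: arg_minnP => [|D sdD minD]; first exact: super_dominatingT.
by split=> //; exists D.
Qed.

Definition twin (x y : V) : bool :=
  (closed_nbh x == closed_nbh y) || (open_nbh x == open_nbh y).

Definition twin_classes : {set {set V}} := equivalence_partition twin setT.

Definition connected_graph : Prop := forall x y : V, connect e x y.

Hypotheses (e_sym : symmetric e) (e_irr : irreflexive e).

Lemma twin_mixed x y z :
  closed_nbh x = closed_nbh y -> open_nbh y = open_nbh z -> x = y \/ y = z.
Proof.
move=> /setP Cxy /setP Oyz.
have [->|nxy] := eqVneq x y; first by left.
right; apply/eqP; apply/negPn/negP => nyz.
have eyx : e y x.
  by have:= Cxy x; rewrite !inE eqxx (negPf nxy).
have ezx : e z x by have:= Oyz x; rewrite !inE eyx.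
have exz : e x z by rewrite e_sym.
have := Cxy z; rewrite !inE exz orbT eq_sym (negPf nyz) /= => eyz.
by have := Oyz z; rewrite !inE e_irr -eyz.
Qed.

Lemma twin_equivalence : {in setT & &, equivalence_rel twin}.
Proof.
have twin_refl x : twin x x by rewrite /twin eqxx.
have twin_sym x y : twin x y = twin y x.
  by rewrite /twin eq_sym (eq_sym (open_nbh x)).
have twin_trans x y z : twin x y -> twin y z -> twin x z.
  rewrite {1 2}/twin => /orP[]/eqP xy /orP[]/eqP yz.
  - by rewrite /twin xy yz eqxx.
  - case: (twin_mixed xy yz) => [->|<-]; by rewrite /twin ?xy ?yz eqxx ?orbT.
  - case: (twin_mixed (esym yz) (esym xy)) => [->|<-];
      by rewrite /twin ?xy ?yz eqxx ?orbT.
  - by rewrite /twin xy yz eqxx orbT.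
move=> x y z _ _ _; split=> // xy; apply/idP/idP; last exact: twin_trans.
by apply: twin_trans; rewrite twin_sym.
Qed.

End SuperDomination.

(* Main.v *)
(** For a super dominating set [D] with complement [U], two distinct twins cannot
both lie in [U]: the vertex of [D] whose only neighbour in [U] is one of them
would also be adjacent to the other. Hence [U] meets each twin class at most
once, so [#|U| <= t]. If [#|U| = t], every vertex has a unique twin in [U].
Replacing by its twin in [U] the vertex of [D] whose only neighbour in [U] is
[u] shows that [U] induces a graph whose components are isolated vertices and
edges. Passing to twins in [U] maps edges of [G] to edges or single vertices of
[U], so if [G] is connected then [U] lies in one such component and [t <= 2]. *)
Require Import Defs.
From mathcomp Require Import all_boot.

Set Implicit Arguments.
Unset Strict Implicit.
Unset Printing Implicit Defensive.

Section TwinClasses.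

Variables (V : finType) (e : rel V).
Hypotheses (e_sym : symmetric e) (e_irr : irreflexive e).

Lemma twin_refl x : twin e x x.
Proof. by rewrite /twin eqxx. Qed.

Lemma twin_sym x y : twin e x y = twin e y x.
Proof. by rewrite /twin eq_sym (eq_sym (open_nbh e x)). Qed.

Lemma twin_trans x y z : twin e x y -> twin e y z -> twin e x z.
Proof.
move=> xy.
have := twin_equivalence e_sym e_irr (in_setT x) (in_setT y) (in_setT z).
by case=> _ /(_ xy) <-.
Qed.

Lemma twin_adj x y z : twin e x y -> z != x -> z != y -> e x z = e y z.
Proof.
move=> /orP[]/eqP/setP/(_ z) xy zx zy; move: xy; rewrite !inE //.
by rewrite (negPf zx) (negPf zy).
Qed.

Section SuperDominating.

Variable D : {set V}.
Hypothesis sdD : super_dominating e D.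

Let U := ~: D.

Lemma super_dominating_private u : u \in U ->
  exists2 v, v \in D & forall w, w \in U -> e v w = (w == u).
Proof.
move=> uU; have /forall_inP/(_ u uU)/exists_inP[v vD /eqP/setP Nv] := sdD.
by exists v => // w wU; move: (Nv w); rewrite in_setI wU andbT !inE.
Qed.

Lemma twin_compl_super_dominating x y :
  x \in U -> y \in U -> twin e x y -> x = y.
Proof.
move=> xU yU xy; have [v vD Nv] := super_dominating_private xU.
have vU z : z \in U -> v != z.
  by move=> zU; apply: contraTneq vD => ->; rewrite -in_setC.
apply/esym/eqP; rewrite -(Nv y yU) e_sym -(twin_adj xy) ?vU //.
by rewrite e_sym Nv.
Qed.

(** Written as a block of [equivalence_partition], so that [twin_classes e] is the image of [setT]
    under [class]. *)
Let class (x : V) : {set V} := [set y in [set: V] | twin e x y].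

Let class_inj : {in U &, injective class}.
Proof.
move=> x y xU yU /setP/(_ y); rewrite !inE twin_refl.
exact: twin_compl_super_dominating.
Qed.

Let class_sub : class @: U \subset twin_classes e.
Proof. by apply/imsetS/subsetT. Qed.

Lemma card_compl_super_dominating : #|U| <= #|twin_classes e|.
Proof. by rewrite -(card_in_imset class_inj) subset_leq_card. Qed.

Lemma card_compl_super_dominating_eq :
  connected_graph e -> #|twin_classes e| <= #|U| -> #|U| <= 2.
Proof.
move=> conn tU.
have classE : class @: U = twin_classes e.
  by apply/eqP; rewrite eqEcard class_sub (card_in_imset class_inj).
have rep x : exists2 y, y \in U & twin e x y.
  have : class x \in class @: U by rewrite classE; apply: imset_f.
  case/imsetP => y yU /setP/(_ y); rewrite !inE twin_refl => xy.
  by exists y.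
have leaf u : u \in U ->
    {in U, forall w, ~~ e u w} \/
    exists2 u', u' \in U & {in U, forall w, e u' w = (w == u)}.
  move=> uU; have [v vD Nv] := super_dominating_private uU.
  have [u' u'U vu'] := rep v.
  have vU z : z \in U -> z != v.
    by move=> zU; apply: contraTneq vD => <-; rewrite -in_setC.
  (* The twin [u'] inherits the adjacencies of [v] except possibly at [u'] itself; hence the split
     on [u' = u]. *)
  have Nu' w : w \in U -> w != u' -> e u' w = (w == u).
    by move=> wU wu'; rewrite -(twin_adj vu') ?vU // Nv.
  have [u'u|u'u] := eqVneq u' u; [left | right].
    move=> w wU; have [->|wu] := eqVneq w u; first by rewrite e_irr.
    by rewrite -u'u Nu' // ?u'u.
  exists u' => // w wU; have [->|wu'] := eqVneq w u'; last exact: Nu'.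
  by rewrite e_irr (negPf u'u).
have [->|[u uU]] := set_0Vmem U; first by rewrite cards0.
(* The component of [u] in the graph induced on [U] is [[set u; u']], with [u' = u] when [u] is
   isolated there. *)
have [u' [u'U Nu Nu']] : exists u', [/\ u' \in U,
    {in U, forall w, e u w -> w = u'} & {in U, forall w, e u' w -> w = u}].
  have [iso|[u' u'U Nu']] := leaf u uU.
    by exists u; split=> // w wU; rewrite (negPf (iso w wU)).
  have eu'u : e u' u by rewrite Nu'.
  exists u'; split=> // w wU; last by rewrite Nu' // => /eqP.
  (* Since [u''] is adjacent to [u'], whose only neighbour in [U] is [u], it equals [u]. *)
  have [/(_ u uU)|[u'' u''U Nu'']] := leaf u' u'U; first by rewrite eu'u.
  have /eqP <- : u'' == u by rewrite -Nu' // e_sym Nu''.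
  by rewrite Nu'' // => /eqP.
(* The vertices represented in that component; closed under adjacency, [S] is everything by
   connectedness. *)
pose S := [pred x | [exists z in [set u; u'], twin e x z]].
have S_rep x z : z \in U -> twin e x z -> x \in S -> z \in [set u; u'].
  move=> zU xz /exists_inP[w wuu' xw]; suff -> : z = w by [].
  apply: twin_compl_super_dominating => //.
    by case/set2P: wuu' => ->.
  by apply: twin_trans xw; rewrite twin_sym.
have S_step x y : e x y -> x \in S -> y \in S.
  have [x1 x1U xx1] := rep x; have [y1 y1U yy1] := rep y.
  move=> exy xS; apply/exists_inP; exists y1 => //.
  have x1uu' := S_rep _ _ x1U xx1 xS.
  have [<- //|x1y1] := eqVneq x1 y1.
  (* Otherwise [y] would lie in [U] and be its own representative, so [x1 = y1]. *)
  have x1y : x1 != y.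
    apply: contraNneq x1y1 => x1y.
    by apply/eqP/twin_compl_super_dominating; rewrite ?x1y // -x1y.
  have yx : y != x by apply: contraTneq exy => ->; rewrite e_irr.
  have ex1y1 : e x1 y1.
    by rewrite e_sym -(twin_adj yy1) // e_sym -(twin_adj xx1) // eq_sym.
  by rewrite !inE; case/set2P: x1uu' ex1y1 => ->;
    [move/(Nu _ y1U)|move/(Nu' _ y1U)] => ->; rewrite eqxx ?orbT.
have S_closed : closed e S.
  by apply: intro_closed S_step; apply: sym_connect_sym.
have uS : u \in S by apply/exists_inP; exists u; rewrite ?set21 ?twin_refl.
have U_sub : U \subset [set u; u'].
  apply/subsetP => w wU; apply: (S_rep w) => //; first exact: twin_refl.
  by rewrite -(closed_connect S_closed (conn u w)).
by rewrite (leq_trans (subset_leq_card U_sub)) // cards2; case: eqP.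
Qed.

End SuperDominating.
End TwinClasses.

Theorem theorem10 (V : finType) (e : rel V)
    (e_sym : symmetric e) (e_irr : irreflexive e)
    (n t : nat) (card_V : #|V| = n) (card_classes : #|twin_classes e| = t) :
  (n - t <= super_domination_number e)%N /\
  (connected_graph e -> (3 <= t)%N ->
   (n - t + 1 <= super_domination_number e)%N).
Proof.
have [[D sdD <-] _] := super_domination_numberP e.
have Ut : #|~: D| <= t.
  by rewrite -card_classes; apply: card_compl_super_dominating.
rewrite -card_V -(cardsC D); split=> [|conn t3].
  by rewrite leq_subLR addnC leq_add2r.
have {}Ut : #|~: D| < t.
  rewrite ltn_neqAle Ut andbT; apply: contraL t3 => /eqP Ut'.
  rewrite -leqNgt -Ut'; apply: card_compl_super_dominating_eq => //.
  by rewrite card_classes Ut'.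
(* Without truncation in [n - t], the successor can move inside the subtraction. *)
have tV : t <= #|D| + #|~: D|.
  by rewrite cardsC -card_classes -[#|V|]cardsT leq_imset_card.
by rewrite addn1 -subSn // leq_subLR -addnS addnC leq_add2r.
Qed.
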